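(* For every integer $r\ge 3$ and every sufficiently large $n$, there exist an $r$-element set $R\subseteq[n]$ and an $R_3$-sum-free set $M\subseteq[n]$ with $|M|>n^{1-o(1)}$ (the $o(1)$ term tending to $0$ as $n\to\infty$).
   Context: $[n]=\{1,\dots,n\}$. Let $R=\{b_1,\dots,b_r\}$ be a set of $r$ distinct nonnegative integers. A set $M$ of integers is $R_3$-sum-free if for every choice of three distinct elements $b_{j_1},b_{j_2},b_{j_3}$ of $R$, the equation $(b_{j_2}-b_{j_1})m_1+(b_{j_3}-b_{j_2})m_2+(b_{j_1}-b_{j_3})m_3=0$ has no solution with $m_1,m_2,m_3\in M$ except the trivial ones $m_1=m_2=m_3$. *)

(* Defs.v *)
From mathcomp Require Import all_boot all_order all_algebra.
From mathcomp Require Import finmap.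
From mathcomp Require Import all_classical all_reals all_analysis.

Set Implicit Arguments.
Unset Strict Implicit.
Unset Printing Implicit Defensive.

Import Order.TTheory GRing.Theory Num.Theory.

Local Open Scope classical_set_scope.
Local Open Scope ring_scope.

(* The differences are taken in int, since subtraction on nat is truncated;
   M is an arbitrary, possibly infinite, set of integers. *)
Definition R3_sum_free (R : {fset nat}) (M : set int) : Prop :=
  forall b1 b2 b3 : nat, b1 \in R -> b2 \in R -> b3 \in R ->
    b1 != b2 -> b2 != b3 -> b3 != b1 ->
  forall m1 m2 m3 : int, M m1 -> M m2 -> M m3 ->
    (b2%:Z - b1%:Z) * m1 + (b3%:Z - b2%:Z) * m2 + (b1%:Z - b3%:Z) * m3 = 0 ->
    m1 = m2 /\ m2 = m3.

(* Main.v *)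
(** Take R = {1, ..., r} and Behrend's set for M: integers whose digits in base
    3rd are all below d and whose digit vectors lie on a common sphere. The
    coefficients a, b, c of an equation are nonzero, sum to 0 and are below r in
    absolute value, so a relation a m1 + b m2 + c m3 = 0 holds digit by digit,
    i.e. it is an affine dependence between three points of the sphere, and these
    must coincide. With k digits, k fixed, this gives |M| > n^(1 - 3/k) for all
    large n; since k is arbitrary, the maximal size of M is n^(1 - o(1)). *)
Require Import Defs.
From mathcomp Require Import all_boot all_order all_algebra.
From mathcomp Require Import finmap zify ring lra.
From mathcomp Require Import all_classical all_reals all_analysis.

Import Order.TTheory GRing.Theory Num.Theory.
Import numFieldNormedType.Exports.

Local Open Scope classical_set_scope.
Local Open Scope fset_scope.
Local Open Scope ring_scope.

(** Split off the lowest coefficient: it is a multiple of [B] smaller than [B] in absolute value,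
    hence zero. Dividing by [B] leaves a relation with one term fewer. *)
Lemma radix_eq0 (B k : nat) (c : 'I_k -> int) :
  (forall i, `|c i| < B%:Z) -> \sum_i c i * B%:Z ^+ i = 0 -> forall i, c i = 0.
Proof.
elim: k c => [|k IHk] c c_lt; first by move=> _ [].
rewrite big_ord_recl expr0 mulr1.
under eq_bigr do rewrite lift0 exprS mulrCA.
rewrite -mulr_sumr => c_sum.
set s := \sum_i _ in c_sum.
have s0 : s = 0 by have := c_lt ord0; nia.
have c0 : c ord0 = 0 by rewrite s0 mulr0 addr0 in c_sum.
move=> i; case: (unliftP ord0 i) => [j|] -> //.
exact: (IHk (fun j => c (lift ord0 j))).
Qed.

Lemma radix_lt (B k : nat) (c : 'I_k -> nat) :
  (forall i, c i < B)%N -> (\sum_i c i * B ^ i < B ^ k)%N.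
Proof.
elim: k c => [|k IHk] c c_lt; first by rewrite big_ord0.
rewrite big_ord_recr expnS /=.
have := IHk _ (fun i => c_lt (widen_ord (leqnSn k) i)).
have /= := c_lt ord_max; nia.
Qed.

(** The three points are collinear, and a line meets a sphere in at most two points; as no weight
    vanishes, two coinciding points force the third. *)
Lemma sphere_noncollinear (I : finType) (x y z : I -> int) (a b c N : int) :
  \sum_i x i ^+ 2 = N -> \sum_i y i ^+ 2 = N -> \sum_i z i ^+ 2 = N ->
  a != 0 -> b != 0 -> c != 0 -> a + b + c = 0 ->
  (forall i, a * x i + b * y i + c * z i = 0) -> x =1 y /\ y =1 z.
Proof.
move=> xN yN zN a0 b0 c0 abc lin.
(* Expanding |c z|^2 = |a x + b y|^2 leaves a b |x - y|^2 = 0. *)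
have key : a * b * \sum_i (x i - y i) ^+ 2 = 0.
  have -> : a * b * (\sum_i (x i - y i) ^+ 2) =
      a * (a + b) * (\sum_i x i ^+ 2) + b * (a + b) * (\sum_i y i ^+ 2)
      - c ^+ 2 * (\sum_i z i ^+ 2).
    rewrite !mulr_sumr -big_split -sumrB /=; apply: eq_bigr => i _.
    have cz : c * z i = - (a * x i + b * y i) by have := lin i; lia.
    by rewrite -[in RHS]exprMn cz; ring.
  rewrite xN yN zN; have -> : c = - (a + b) by lia.
  ring.
have xy : x =1 y.
  move: key => /eqP; rewrite !mulf_eq0 (negPf a0) (negPf b0) /=.
  rewrite psumr_eq0 => [/allP xy i|i _]; last exact: sqr_ge0.
  by apply/eqP; rewrite -subr_eq0 -sqrf_eq0; apply: xy; rewrite mem_index_enum.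
split=> // i; have := lin i; rewrite xy.
have -> : c = - (a + b) by lia.
have : a + b != 0 by lia.
nia.
Qed.

(** Pigeonhole: the [d ^ k] vectors have at most [k * d ^ 2 + 1] squared norms, which is at most
    [k.+1 * d ^ 2] because [d] is positive. *)
Lemma large_sphere (k d : nat) : (0 < d)%N -> exists N : nat,
  (d ^ k <= #|[set v : {ffun 'I_k -> 'I_d} | \sum_i v i ^ 2 == N]%N%SET|
            * (k.+1 * d ^ 2))%N.
Proof.
move=> d_gt0; pose m := (k * d ^ 2).+1.
have norm_lt (v : {ffun 'I_k -> 'I_d}) : (\sum_i v i ^ 2 < m)%N.
  rewrite ltnS -[k in leqRHS]card_ord -sum_nat_const leq_sum // => i _.
  by rewrite leq_exp2r // ltnW.
pose F (j : 'I_m) := #|[set v : {ffun 'I_k -> 'I_d} | \sum_i v i ^ 2 == j]%N%SET|.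
have [|j Fj] := bigop.eq_bigmax F; first by rewrite card_ord.
exists j; rewrite -/(F j) -Fj.
have -> : (d ^ k = \sum_j F j)%N.
  rewrite -[d in LHS]card_ord -[k in LHS]card_ord -card_ffun -sum1_card.
  rewrite (partition_big (fun v => Ordinal (norm_lt v)) xpredT) //=.
  apply: eq_bigr => i _; rewrite /F -sum1dep_card; exact: eq_bigl.
apply: (@leq_trans (m * \max_j F j)%N).
  have <- : (\sum_(i < m) \max_j F j = m * \max_j F j)%N by rewrite sum_nat_const card_ord.
  apply: leq_sum => i _; exact: bigop.leq_bigmax.
rewrite mulnC leq_mul2l; apply/orP; right.
by rewrite /m mulSn -addn1 addnC leq_add2r expn_gt0 d_gt0.
Qed.

(** For [d <= B] the shift by 1 puts the values between 1 and [B ^ k]; it cancels in any equation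
    whose coefficients sum to 0. *)
Definition encode (k d B : nat) (v : {ffun 'I_k -> 'I_d}) : int :=
  (\sum_i v i * B ^ i)%N%:Z + 1.
Arguments encode {k d} B v.

Lemma encodeE (k d B : nat) (v : {ffun 'I_k -> 'I_d}) :
  encode B v = \sum_i (v i)%:Z * B%:Z ^+ i + 1.
Proof.
rewrite /encode -natz natr_sum; congr (_ + 1); apply: eq_bigr => i _.
by rewrite natrM natrX !natz.
Qed.

Lemma encode_inj (k d B : nat) : (d <= B)%N -> injective (encode B : {ffun 'I_k -> 'I_d} -> int).
Proof.
move=> dB u v; rewrite !encodeE => /addIr/eqP.
rewrite -subr_eq0 -sumrB.
under eq_bigr do rewrite -mulrBl.
move=> /eqP /(@radix_eq0 _ _ (fun i => (u i)%:Z - (v i)%:Z)) uv.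
apply/ffunP => i; apply/val_inj => /=.
have /uv/(_ i) : forall i, `|(u i)%:Z - (v i)%:Z| < B%:Z.
  by move=> j; have := ltn_ord (u j); have := ltn_ord (v j); lia.
by lia.
Qed.

Definition interval_fset (r : nat) : {fset nat} := [fset b in iota 1 r].

Definition admissible (r n c : nat) := exists M : {fset int},
  [/\ #|` M| = c, forall m : int, m \in M -> 1 <= m <= n%:Z
    & R3_sum_free (interval_fset r) [set` M]].

Lemma sphere_admissible (r k d n N : nat) : (0 < r)%N -> ((3 * r * d) ^ k <= n)%N ->
  admissible r n #|[set v : {ffun 'I_k -> 'I_d} | \sum_i v i ^ 2 == N]%N%SET|.
Proof.
move=> r_gt0 le_n; set S := [set v | _]%SET; set B := (3 * r * d)%N in le_n.
have dB : (d <= B)%N by rewrite /B; nia.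
exists [fset encode B v | v in S]; split.
- by rewrite card_imfset ?cardE //; exact: encode_inj.
- move=> m /imfsetP[v _ ->]; rewrite /encode.
  have /= := radix_lt B k (fun i => v i) (fun i => leq_trans (ltn_ord _) dB).
  by move: (\sum_i _)%N (B ^ k)%N le_n => s b; lia.
move=> b1 b2 b3; rewrite !inE !mem_iota => b1r b2r b3r b12 b23 b31 m1 m2 m3.
move=> /imfsetP[/= x + ->] /imfsetP[/= y + ->] /imfsetP[/= z + ->].
rewrite !inE => /eqP xN /eqP yN /eqP zN.
set a := b2%:Z - _; set b := b3%:Z - _; set c := b1%:Z - _.
have [a0 b0 c0] : [/\ a != 0, b != 0 & c != 0] by rewrite /a /b /c; split; lia.
have [ar br cr] : [/\ `|a| < r%:Z, `|b| < r%:Z & `|c| < r%:Z].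
  by rewrite /a /b /c; split; lia.
have abc : a + b + c = 0 by rewrite /a /b /c; lia.
clearbody a b c.
rewrite !encodeE => eq0.
have /radix_eq0 dig : \sum_i (a * (x i)%:Z + b * (y i)%:Z + c * (z i)%:Z) * B%:Z ^+ i = 0.
  transitivity (a * (\sum_i (x i)%:Z * B%:Z ^+ i + 1)
     + b * (\sum_i (y i)%:Z * B%:Z ^+ i + 1)
     + c * (\sum_i (z i)%:Z * B%:Z ^+ i + 1) - (a + b + c)); last first.
    by rewrite eq0 abc.
  rewrite !mulrDr !mulr1 !mulr_sumr.
  under eq_bigr do rewrite !mulrDl -!mulrA.
  by rewrite !big_split /=; ring.
have norm (v : {ffun 'I_k -> 'I_d}) : (\sum_i v i ^ 2 = N)%N ->
    \sum_i (v i)%:Z ^+ 2 = N%:Z.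
  move=> <-; rewrite -[RHS]natz natr_sum; apply: eq_bigr => i _.
  by rewrite natrX natz.
have [|xy yz] := @sphere_noncollinear _ (fun i => (x i)%:Z) (fun i => (y i)%:Z)
  (fun i => (z i)%:Z) a b c N (norm _ xN) (norm _ yN) (norm _ zN) a0 b0 c0 abc.
  apply: dig => i.
  have xd := ltn_ord (x i); have yd := ltn_ord (y i); have zd := ltn_ord (z i).
  (* Three such products add up to less than [3 * r * d] in absolute value, which is the reason for
     the base [B]. *)
  have bd (t : int) (u : nat) : `|t| < r%:Z -> (u < d)%N -> `|t * u%:Z| < r%:Z * d%:Z.
    by move=> tr ud; rewrite normrM; nia.
  have := bd _ _ ar xd; have := bd _ _ br yd; have := bd _ _ cr zd.
  rewrite /B; lia.
have -> : x = y by apply/ffunP => i; apply/val_inj; case: (xy i).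
by have -> : y = z by apply/ffunP => i; apply/val_inj; case: (yz i).
Qed.

(* With [k] digits below [d], [(3 r d) ^ k <= n < (6 r d) ^ k] and a largest
   sphere has at least [d ^ (k - 2) / (k + 1)] points: up to a constant factor
   absorbed by a third power of [n ^ (1/k)], this is [n ^ (1 - 2/k)]. *)
Lemma behrend (r k : nat) : (0 < r)%N -> (0 < k)%N ->
  exists N : nat, forall n : nat, (N <= n)%N ->
    exists2 c : nat, admissible r n c & (n ^ k < c ^ k * n ^ 3)%N.
Proof.
move=> r_gt0 k_gt0; pose C := (k.+1 * (6 * r) ^ k)%N.
(* The first summand makes [d = 1] eligible, the second gives [C ^ k < n] for the final estimate. *)
exists ((3 * r) ^ k + (C ^ k).+1)%N => n le_n.
pose P d := ((3 * r * d) ^ k <= n)%N.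
have P1 : P 1 by rewrite /P muln1; lia.
have P_le d : P d -> (d <= n)%N.
  move=> Pd; apply: leq_trans Pd; case: k k_gt0 {C le_n P P1} => // k _.
  case: d => // d; have : (0 < 3 * r * d.+1)%N by nia.
  by move=> /leq_pexp2l/(_ (ltn0Sn k)); apply: leq_trans; rewrite expn1; nia.
case: (ex_maxnP (ex_intro P 1%N P1) P_le) => d Pd d_max.
have d_gt0 : (0 < d)%N := d_max _ P1.
have [N cN] := large_sphere k d d_gt0.
set c := #|_| in cN; exists c; first exact: sphere_admissible.
have dk_le : (d ^ k <= n)%N.
  by apply: leq_trans Pd; rewrite leq_exp2r //; nia.
have n_lt : (n < (6 * r) ^ k * d ^ k)%N.
  rewrite -expnMn ltnNge; apply/negP => le6.
  (* Since [d >= 1], [3 * r * d.+1 <= 6 * r * d], so [d.+1] would contradict maximality. *)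
  have /d_max : P d.+1 by apply: leq_trans le6; rewrite leq_exp2r //; nia.
  by rewrite ltnn.
have n_le : (n <= C * c * d ^ 2)%N by rewrite /C; nia.
have c_gt0 : (0 < c)%N by case: c n_le n_lt cN => // ; nia.
have : (n ^ k <= (C * c * d ^ 2) ^ k)%N by rewrite leq_exp2r.
have -> : ((C * c * d ^ 2) ^ k = C ^ k * c ^ k * (d ^ k) ^ 2)%N.
  by rewrite (expnMn (C * c)) (expnMn C) -!(expnM d) (mulnC 2%N).
move=> /leq_ltn_trans; apply; rewrite mulnAC mulnC ltn_pmul2l ?expn_gt0 ?c_gt0 //.
apply: (@leq_ltn_trans (C ^ k * n ^ 2)); first by rewrite leq_mul2l leq_exp2r ?dk_le ?orbT.
rewrite [ltnRHS]expnS ltn_pmul2r; first by lia.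
by rewrite expn_gt0; lia.
Qed.

Lemma admissible_le (r n c : nat) : admissible r n c -> (c <= n)%N.
Proof.
move=> [M [<- M_le _]].
have /fsubsetP/fsubset_leq_card/leq_trans : {subset M <= [fset i in [seq i%:Z | i <- iota 1 n]]}.
  move=> m mM; rewrite inE; apply/mapP; exists `|m|%N => /=.
    by rewrite mem_iota; have := M_le m mM; lia.
  by have := M_le m mM; lia.
by apply; rewrite card_fseq (leq_trans (size_undup _)) // size_map size_iota.
Qed.

(** The threshold in [behrend] depends on [k]. A set of maximal size does not, so it satisfies the
    bounds for all [k], each from its own threshold on. *)
Lemma max_admissible (r : nat) : {f : nat -> nat | forall n,
  admissible r n (f n) /\ forall c, admissible r n c -> (c <= f n)%N}.
Proof.
suff /boolp.choice[f fP] : forall n, exists m,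
    admissible r n m /\ forall c, admissible r n c -> (c <= m)%N by exists f.
move=> n; have ex0 : exists c, `[< admissible r n c >].
  exists 0%N; apply/asboolP; exists fset0; split; first exact: cardfs0.
    by move=> m; rewrite inE.
  by move=> b1 b2 b3 _ _ _ _ _ _ m1 m2 m3; rewrite /= inE.
have le_n c : `[< admissible r n c >] -> (c <= n)%N by move=> /asboolP/admissible_le.
case: (ex_maxnP ex0 le_n) => m /asboolP mP m_max.
by exists m; split=> // c /asboolP/m_max.
Qed.

Theorem theorem10 (K : realType) (r : nat) (hr : (3 <= r)%N) :
  exists e : nat -> K,
    e n @[n --> \oo] --> (0 : K) /\
    exists N : nat, forall n : nat, (N <= n)%N ->
      exists (R : {fset nat}) (M : {fset int}),
        [/\ #|` R| = r,
            forall b : nat, b \in R -> (1 <= b <= n)%N,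
            forall m : int, m \in M -> 1 <= m <= n%:Z,
            R3_sum_free R [set` M] &
            n%:R `^ (1 - e n) < #|` M|%:R :> K].
Proof.
have r_gt0 : (0 < r)%N by lia.
have [f fP] := max_admissible r.
have f_le n : (f n <= n)%N by apply: admissible_le (fP n).1.
have f_ge k : (0 < k)%N -> exists N : nat, forall n, (N <= n)%N ->
    (n ^ k < f n ^ k * n ^ 3)%N.
  move=> k_gt0; have [N NP] := behrend _ _ r_gt0 k_gt0; exists N => n /NP[c cP /leq_trans].
  by apply; rewrite leq_mul2r leq_exp2r // (fP n).2 ?orbT.
have [N1 f1] := f_ge 1%N isT.
(* For [n > 1] and [f n > 0] this is the exact deficit: [f n] equals [n] to the power [1 - g n]. *)
pose g n : K := 1 - ln (f n)%:R / ln n%:R.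
(* The positive null sequence [harmonic] makes the final inequality strict. *)
exists (fun n => g n + harmonic n); split.
  rewrite -[0]addr0; apply: cvgD; last exact: cvg_harmonic.
  apply/cvgrPdist_lt => eps eps_gt0.
  (* Taking logarithms in [n ^ k < f n ^ k * n ^ 3] gives [g n < 3 / k], which is below [eps] for
     this [k]. *)
  have [k k_gt0 k_gt] : exists2 k, (0 < k)%N & 3 / eps < k%:R.
    by exists (Num.trunc (3 / eps)).+1 => //; exact: truncnS_gt.
  have [N NP] := f_ge k k_gt0.
  near=> n.
  have n_gt1 : (1 < n)%N by near: n; exact: nbhs_infty_ge.
  have n_ge : (N <= n)%N by near: n; exact: nbhs_infty_ge.
  have lnn : 0 < ln (n%:R : K) by rewrite ln_gt0 // ltr1n.
  have fn := NP n n_ge.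
  have fn0 : (0 < f n)%N by case: (f n) fn => //; rewrite exp0n.
  have up : ln (f n)%:R <= ln (n%:R : K).
    by rewrite ler_ln ?posrE ?ltr0n ?ler_nat //; lia.
  have lo : ln (n%:R : K) *+ k < ln (f n)%:R *+ k + ln n%:R *+ 3.
    have n0 : 0 < n%:R :> K by rewrite ltr0n; lia.
    have f0 : 0 < (f n)%:R :> K by rewrite ltr0n.
    rewrite -!lnXn // -lnM ?posrE ?exprn_gt0 // ltr_ln ?posrE ?mulr_gt0 ?exprn_gt0 //.
    by rewrite -!natrX -natrM ltr_nat.
  have k3 : 3 < k%:R * eps by rewrite -ltr_pdivrMr.
  rewrite sub0r normrN ger0_norm /g; last by rewrite subr_ge0 ler_pdivrMr // mul1r.
  rewrite ltrBlDr -ltrBlDl ltr_pdivlMr //.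
  have k0 : 0 < k%:R :> K by rewrite ltr0n.
  rewrite -(ltr_pM2l k0).
  rewrite -(ltr_pM2r lnn) in k3.
  rewrite -(mulr_natl _ k) -(mulr_natl (ln (f n)%:R)) -(mulr_natl _ 3) in lo.
  move: (ln _) (ln _) (k%:R) lo k3 => u v w; lra.
(* [N1] ensures [f n > 0], [r] ensures that [R] lies in [n], and 2 ensures [ln n > 0]. *)
exists (N1 + r + 2)%N => n n_ge.
have [M [cM M_le M_free]] := (fP n).1.
exists (interval_fset r), M; split=> //.
- by rewrite card_fseq undup_id ?iota_uniq // size_iota.
- by move=> b; rewrite !inE mem_iota; lia.
have fn0 : (0 < f n)%N.
  have /f1 : (N1 <= n)%N by lia.
  by rewrite !expn1; case: (f n).
have lnn : 0 < ln (n%:R : K) by rewrite ln_gt0 // ltr1n; lia.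
rewrite cM -ltr_ln ?posrE ?powR_gt0 ?ltr0n //; last by lia.
rewrite ln_powR /g opprD addrA subKr mulrBl divfK ?gt_eqF //.
by rewrite ltrBlDr ltrDl mulr_gt0 // invr_gt0 ltr0n.
Unshelve. all: by end_near.
Qed.
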